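(* Let $G=v*H$, where $H$ is a disconnected graph on $[n]$. Then $$\operatorname{depth}_S(S/J_G)=\min\{\operatorname{depth}_{S_H}(S_H/J_H),\ n+2\}.$$
   Context: $\mathbb{K}$ is an arbitrary field and all graphs are finite and simple; $[n]=\{1,\dots,n\}$. For a graph $\Gamma$, its binomial edge ideal $J_\Gamma$ is the ideal of the polynomial ring $\mathbb{K}[x_u,y_u : u\in V(\Gamma)]$ generated by the binomials $x_uy_w-x_wy_u$ with $\{u,w\}\in E(\Gamma)$. The cone $v*H$ has vertex set $V(H)\sqcup\{v\}$ and edge set $E(H)\sqcup\{\{v,u\} : u\in V(H)\}$. Put $S_H=\mathbb{K}[x_i,y_i : i\in V(H)]$ and $S=S_H[x_v,y_v]$. Depth is with respect to the graded maximal ideal. *)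

(* Defs.v *)
From mathcomp Require Import all_boot all_order all_algebra.
From mathcomp.multinomials Require Import mpoly.

Set Implicit Arguments.
Unset Strict Implicit.
Unset Printing Implicit Defensive.

Import GRing.Theory.
Local Open Scope ring_scope.

Record sgraph (V : finType) := SGraph {
  adj :> rel V;
  adj_sym : ssrbool.symmetric adj;
  adj_irr : irreflexive adj
}.

(* Asking for two vertices not joined by a path makes the graph with no
   vertex not disconnected. *)
Definition disconnected (V : finType) (H : sgraph V) : Prop :=
  exists u w : V, ~~ connect (adj H) u w.

Section Cone.
Variables (V : finType) (H : sgraph V).

(* The apex v is None. *)
Definition cone_adj : rel (option V) := fun a b =>
  match a, b with
  | Some u, Some w => adj H u w
  | None, None => false
  | _, _ => true
  end.

Lemma cone_adj_sym : ssrbool.symmetric cone_adj.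
Proof. by move=> [u|] [w|] //=; apply: adj_sym. Qed.

Lemma cone_adj_irr : irreflexive cone_adj.
Proof. by move=> [u|] //=; apply: adj_irr. Qed.

Definition cone : sgraph (option V) := SGraph cone_adj_sym cone_adj_irr.
End Cone.

Section Depth.
Variable S : comNzRingType.

(* Ideals are represented by their membership predicates. *)
Definition ideal_gen (P : S -> Prop) : S -> Prop := fun g =>
  exists s : seq (S * S),
    (forall p, p \in s -> P p.2) /\ g = \sum_(p <- s) p.1 * p.2.

(* I + (f) for an ideal I *)
Definition ideal_add (I : S -> Prop) (f : S) : S -> Prop := fun g =>
  exists a b : S, I a /\ g = a + b * f.

(* s = [:: f_1; ...; f_k] is a regular sequence on the S-module S/I: each f_i
   is a nonzerodivisor on S/(I + (f_1, ..., f_(i-1))) and the quotient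
   S/(I + (f_1, ..., f_k)) is nonzero. *)
Fixpoint regular_seq (I : S -> Prop) (s : seq S) : Prop :=
  match s with
  | [::] => ~ I 1
  | f :: s' => (forall g, I (f * g) -> I g) /\ regular_seq (ideal_add I f) s'
  end.

(* depth of S/I with respect to the ideal m: the largest length of a
   regular sequence on S/I with all its terms in m. *)
Definition is_depth (m I : S -> Prop) (d : nat) : Prop :=
  (exists s : seq S,
     [/\ forall f, f \in s -> m f, regular_seq I s & size s = d]) /\
  (forall s : seq S,
     (forall f, f \in s -> m f) -> regular_seq I s -> (size s <= d)%N).

Lemma is_depth_inj (m I : S -> Prop) (d d' : nat) :
  is_depth m I d -> is_depth m I d' -> d = d'.
Proof.
move=> [[s [sm sr <-]] ub] [[s' [sm' sr' <-]] ub'].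
by apply/eqP; rewrite eqn_leq ub' ?ub.
Qed.
End Depth.

Section BinomialEdgeIdeal.
Variables (K : fieldType) (V : finType).

(* K[x_u, y_u : u in V]: the first #|V| variables are the x_u, the last #|V|
   are the y_u, with V numbered by enum_rank. *)
Definition xvar (u : V) : {mpoly K[#|V| + #|V|]} := 'X_(lshift #|V| (enum_rank u)).
Definition yvar (u : V) : {mpoly K[#|V| + #|V|]} := 'X_(rshift #|V| (enum_rank u)).

Definition graded_max_ideal : {mpoly K[#|V| + #|V|]} -> Prop :=
  ideal_gen (fun f => exists u : V, f = xvar u \/ f = yvar u).

Definition binomial_edge_ideal (G : sgraph V) :
    {mpoly K[#|V| + #|V|]} -> Prop :=
  ideal_gen (fun f => exists u w : V,
    adj G u w /\ f = xvar u * yvar w - xvar w * yvar u).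

(* depth of K[x_u, y_u : u in V] / J_G equals d *)
Definition depth_mod_J (G : sgraph V) (d : nat) : Prop :=
  is_depth graded_max_ideal (binomial_edge_ideal G) d.
End BinomialEdgeIdeal.

Arguments depth_mod_J K {V} G d.

(* Main.v *)
(* Write B = J_H + (x_v, y_v) and let J(K) be the ideal of the complete graph on n + 1
   vertices.  Then J_G is the intersection of J(K) and B, and J(K) + B is
   (x_v, y_v) + J(K_n).  The quotients by J(K) and J(K) + B have depths n + 2 and n + 1:
   if T is the ideal of a clique containing a, then x_a is regular modulo T, and T + (x_a)
   is the intersection of the ideal of the clique without a (plus x_a, y_a) with the ideal
   of all the x's, so that induction applies.  As H is disconnected, B lies in the ideal C
   of two disjoint cliques covering H, of depth n + 2, and C lies in J(K) + B.

   No homological algebra is needed to compare the depths.  By prime avoidance there is an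
   element regular modulo J(K), B, C and J(K) + B simultaneously, and factoring it out
   preserves the whole configuration, so one may assume that one of the depths is 0.  If B
   has a socle element u, then u lies in C (which has positive depth), so u = a + b with a
   in J(K) and b in B, and a is a socle element for the intersection.  If instead
   J(K) + B has a socle element u and f is regular, write f u = a + b; then a is a socle
   element for the intersection plus (f). *)

From Stdlib Require Import Classical ClassicalEpsilon FunctionalExtensionality PropExtensionality.
From Stdlib Require List.
From HB Require Import structures.
From mathcomp Require Import all_boot all_order all_algebra.
From mathcomp Require Import ring.
From mathcomp.multinomials Require Import mpoly.
Require Import Defs.

Set Implicit Arguments.
Unset Strict Implicit.
Unset Printing Implicit Defensive.

Import Order.TTheory GRing.Theory.
Local Open Scope ring_scope.

(** * Ideals and prime avoidance *)

Lemma In_map (T : eqType) (U : Type) (g : T -> U) (s : seq T) (y : U) :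
  List.In y [seq g x | x <- s] <-> exists2 x, x \in s & y = g x.
Proof.
elim: s => [|x s IH] /=; first by split=> [|[]].
rewrite IH; split=> [[<-|[z zs ->]]|[z]].
- by exists x => //; rewrite inE eqxx.
- by exists z => //; rewrite inE zs orbT.
- by rewrite inE => /predU1P[-> ->|zs ->]; [left | right; exists z].
Qed.

Section Ideals.
Variable S : comNzRingType.
Implicit Types (I J P Q : S -> Prop) (f g u : S).

Record is_ideal I : Prop := IsIdeal {
  ideal0 : I 0;
  idealD : forall a b, I a -> I b -> I (a + b);
  idealMl : forall r a, I a -> I (r * a) }.

Definition sub_ideal I J := forall x, I x -> J x.
Definition ideal_cap I J : S -> Prop := fun x => I x /\ J x.
Definition ideal_sum I J : S -> Prop := fun x => exists a b, [/\ I a, J b & x = a + b].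
Definition pred_or P Q : S -> Prop := fun x => P x \/ Q x.
Definition regular_on I f := forall g, I (f * g) -> I g.

Lemma ideal_ext I J : sub_ideal I J -> sub_ideal J I -> I = J.
Proof.
move=> IJ JI; apply: functional_extensionality => x.
by apply: propositional_extensionality; split; [apply: IJ | apply: JI].
Qed.

Lemma idealMr I r a : is_ideal I -> I a -> I (a * r).
Proof. by move=> hI Ia; rewrite mulrC; apply: idealMl. Qed.

Lemma idealB I a b : is_ideal I -> I a -> I b -> I (a - b).
Proof.
by move=> hI Ia Ib; rewrite -mulN1r; apply: idealD => //; apply: idealMl.
Qed.

Lemma idealDl I a b : is_ideal I -> I a -> I (a + b) -> I b.
Proof. by move=> hI Ia /idealB-/(_ _ hI Ia); rewrite addrAC subrr add0r. Qed.

Lemma idealDr I a b : is_ideal I -> I b -> I (a + b) -> I a.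
Proof. by rewrite addrC; apply: idealDl. Qed.

Lemma ideal_sumr I (T : eqType) (r : seq T) (F : T -> S) :
  is_ideal I -> (forall i, i \in r -> I (F i)) -> I (\sum_(i <- r) F i).
Proof.
move=> hI hF; rewrite big_seq; elim/big_rec: _ => [|i x ir Ix].
  exact: ideal0.
by apply: idealD => //; apply: hF.
Qed.

Lemma is_ideal_gen P : is_ideal (ideal_gen P).
Proof.
split.
- by exists [::]; rewrite big_nil; split.
- move=> _ _ [s [hs ->]] [t [ht ->]]; exists (s ++ t).
  by rewrite big_cat; split=> // p; rewrite mem_cat => /orP[/hs|/ht].
- move=> r _ [s [hs ->]]; exists [seq (r * p.1, p.2) | p <- s]; split.
    by move=> q /mapP[p /hs Pp ->].
  by rewrite big_map mulr_sumr; apply: eq_bigr => p _; rewrite mulrA.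
Qed.

Lemma ideal_gen_mem P f : P f -> ideal_gen P f.
Proof.
move=> Pf; exists [:: (1, f)]; rewrite big_seq1 mul1r; split=> // p.
by rewrite inE => /eqP ->.
Qed.

Lemma ideal_gen_sub P I : is_ideal I -> sub_ideal P I -> sub_ideal (ideal_gen P) I.
Proof.
move=> hI PI _ [s [hs ->]]; apply: ideal_sumr => // p ps.
by apply: idealMl => //; apply/PI/hs.
Qed.

Lemma ideal_gen_mono P Q : sub_ideal P Q -> sub_ideal (ideal_gen P) (ideal_gen Q).
Proof.
by move=> PQ; apply: ideal_gen_sub; [apply: is_ideal_gen | move=> x /PQ /ideal_gen_mem].
Qed.

Lemma is_ideal_add I f : is_ideal I -> is_ideal (ideal_add I f).
Proof.
move=> hI; split.
- by exists 0, 0; split; [apply: ideal0 | ring].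
- move=> _ _ [a [b [Ia ->]]] [c [d [Ic ->]]]; exists (a + c), (b + d).
  by split; [apply: idealD | ring].
- move=> r _ [a [b [Ia ->]]]; exists (r * a), (r * b).
  by split; [apply: idealMl | ring].
Qed.

Lemma sub_ideal_add I f : sub_ideal I (ideal_add I f).
Proof. by move=> x Ix; exists x, 0; split=> //; ring. Qed.

Lemma ideal_add_mem I f r : is_ideal I -> ideal_add I f (r * f).
Proof. by move=> hI; exists 0, r; split; [apply: ideal0 | rewrite add0r]. Qed.

Lemma ideal_add_min I J f : is_ideal J -> sub_ideal I J -> J f -> sub_ideal (ideal_add I f) J.
Proof.
by move=> hJ IJ Jf _ [a [b [Ia ->]]]; apply: idealD; [|apply: IJ|apply: idealMl].
Qed.

Lemma ideal_add_mono I J f : sub_ideal I J -> sub_ideal (ideal_add I f) (ideal_add J f).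
Proof. by move=> IJ _ [a [b [Ia ->]]]; exists a, b; split=> //; apply: IJ. Qed.

Lemma ideal_addC I f g : ideal_add (ideal_add I f) g = ideal_add (ideal_add I g) f.
Proof.
have sub f1 f2 : sub_ideal (ideal_add (ideal_add I f1) f2) (ideal_add (ideal_add I f2) f1).
  move=> _ [_ [b [[a [c [Ia ->]]] ->]]]; exists (a + b * f2), c.
  by split; [exists a, b | ring].
by apply: ideal_ext; apply: sub.
Qed.

Lemma ideal_gen_add P f : ideal_add (ideal_gen P) f = ideal_gen (pred_or P (eq f)).
Proof.
apply: ideal_ext.
  apply: ideal_add_min; first exact: is_ideal_gen.
    by apply: ideal_gen_mono; left.
  by apply: ideal_gen_mem; right.
apply: ideal_gen_sub; first exact/is_ideal_add/is_ideal_gen.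
move=> x [Px|<-]; first exact/sub_ideal_add/ideal_gen_mem.
by have := ideal_add_mem f 1 (is_ideal_gen P); rewrite mul1r.
Qed.

Lemma is_ideal_cap I J : is_ideal I -> is_ideal J -> is_ideal (ideal_cap I J).
Proof.
move=> hI hJ; split; first by split; apply: ideal0.
- by move=> a b [Ia Ja] [Ib Jb]; split; apply: idealD.
- by move=> r a [Ia Ja]; split; apply: idealMl.
Qed.

Lemma is_ideal_sum I J : is_ideal I -> is_ideal J -> is_ideal (ideal_sum I J).
Proof.
move=> hI hJ; split; first by exists 0, 0; rewrite addr0; split=> //; apply: ideal0.
- move=> _ _ [a [b [Ia Jb ->]]] [c [d [Ic Jd ->]]]; exists (a + c), (b + d).
  by split; [apply: idealD | apply: idealD | ring].
- move=> r _ [a [b [Ia Jb ->]]]; exists (r * a), (r * b).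
  by split; [apply: idealMl | apply: idealMl | ring].
Qed.

Lemma ideal_gen_sum P Q :
  ideal_sum (ideal_gen P) (ideal_gen Q) = ideal_gen (pred_or P Q).
Proof.
apply: ideal_ext.
  move=> _ [a [b [Pa Qb ->]]]; apply: idealD; first exact: is_ideal_gen.
    by apply: ideal_gen_mono Pa; left.
  by apply: ideal_gen_mono Qb; right.
apply: ideal_gen_sub; first by apply: is_ideal_sum; apply: is_ideal_gen.
move=> x [Px|Qx].
  exists x, 0; rewrite addr0; split=> //; first exact: ideal_gen_mem.
  exact: (ideal0 (is_ideal_gen _)).
exists 0, x; rewrite add0r; split=> //; last exact: ideal_gen_mem.
exact: (ideal0 (is_ideal_gen _)).
Qed.

(** * Noetherian rings and the associated primes that cover the zero divisors *)

Definition ideal_strict I J := [/\ is_ideal J, sub_ideal I J & exists2 f, J f & ~ I f].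

(** The ascending chain condition as accessibility, which directly gives induction from larger
    ideals to smaller ones. *)
Definition noetherian := forall I, is_ideal I -> Acc (fun J I => ideal_strict I J) I.

Definition colon I u : S -> Prop := fun f => I (f * u).

Lemma is_ideal_colon I u : is_ideal I -> is_ideal (colon I u).
Proof.
move=> hI; split; first by rewrite /colon mul0r; apply: ideal0.
- by move=> a b Ia Ib; rewrite /colon mulrDl; apply: idealD.
- by move=> r a Ia; rewrite /colon -mulrA; apply: idealMl.
Qed.

Definition is_prime I := [/\ is_ideal I, ~ I 1 & forall f g, I (f * g) -> I f \/ I g].

(** Elements of [P] are added one at a time; each one outside the ideal generated so far enlarges it
    strictly. That the generators come from [P] itself matters in [zero_divisor_primes]. *)
Lemma noetherian_fin_gen : noetherian -> forall P, exists s : seq S,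
  (forall f, f \in s -> P f) /\ sub_ideal P (ideal_gen (fun f => f \in s)).
Proof.
move=> noeth P.
suff gen J : Acc (fun J I => ideal_strict I J) J -> forall t : seq S,
    J = ideal_gen (fun f => f \in t) -> (forall f, f \in t -> P f) ->
    exists s : seq S,
      (forall f, f \in s -> P f) /\ sub_ideal P (ideal_gen (fun f => f \in s)).
  by apply: (gen _ (noeth _ (is_ideal_gen _)) [::]).
elim=> {}J _ IH t defJ tP.
have [le|] := classic (sub_ideal P J); first by exists t; rewrite -defJ.
move/not_all_ex_not => [f] nle; have [Pf nJf] := imply_to_and _ _ nle.
apply: (IH (ideal_gen (fun g => g \in f :: t)) _ (f :: t)) => //.
  split; first exact: is_ideal_gen.
    by rewrite defJ; apply: ideal_gen_mono => x xt; rewrite inE xt orbT.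
  by exists f => //; apply: ideal_gen_mem; rewrite inE eqxx.
by move=> g; rewrite inE => /predU1P[->|/tP].
Qed.

(** [colon I u] is the annihilator of the class of [u] in S/I; the elements singled out here have a
    maximal one among nonzero classes, which makes it an associated prime. *)
Definition max_colon I u := ~ I u /\
  forall u', ~ I u' -> sub_ideal (colon I u) (colon I u') -> sub_ideal (colon I u') (colon I u).

Lemma max_colon_exists I u : noetherian -> is_ideal I -> ~ I u ->
  exists2 u', max_colon I u' & sub_ideal (colon I u) (colon I u').
Proof.
move=> noeth hI; have := noeth _ (is_ideal_colon u hI).
move eqJ: (colon I u) => J accJ; elim: accJ u eqJ => {}J _ IH u defJ nIu.
have [maxu|] := classic (max_colon I u); first by exists u => //; rewrite defJ.
move=> /not_and_or[//|/not_all_ex_not[v nmax]].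
have [nIv nmax'] := imply_to_and _ _ nmax.
have [uv] := imply_to_and _ _ nmax'.
move/not_all_ex_not => [f nf]; have [vf nuf] := imply_to_and _ _ nf.
have [|w maxw vw] := IH (colon I v) _ v erefl nIv.
  by rewrite -defJ; split=> //; [apply: is_ideal_colon | exists f].
by exists w => // x; rewrite -defJ => /uv /vw.
Qed.

(** If f g u is in [I] but g u is not, the annihilator of g u contains that of u, hence equals it by
    maximality, and it contains f. *)
Lemma max_colon_prime I u : is_ideal I -> max_colon I u -> is_prime (colon I u).
Proof.
move=> hI [nIu maxu]; split; first exact: is_ideal_colon.
  by rewrite /colon mul1r.
move=> f g Ifgu; have [Igu|nIgu] := classic (colon I u g); first by right.
left; apply: (maxu (g * u)) => //.
  by move=> h; rewrite /colon mulrCA; apply: idealMl.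
by rewrite /colon mulrA.
Qed.

(** The witness is an element of [m] outside [J] times one element outside [J] from each [Q] not
    contained in [J]; primality keeps the product outside [J]. *)
Lemma prime_avoids_ideals J m (Qs : seq (S -> Prop)) :
    is_prime J -> is_ideal m -> ~ sub_ideal m J ->
    (forall Q, List.In Q Qs -> is_ideal Q) ->
  exists h, [/\ m h, ~ J h & forall Q, List.In Q Qs -> sub_ideal Q J \/ Q h].
Proof.
move=> [hJ nJ1 prJ] hm nmJ; elim: Qs => [_|Q Qs IH hQ].
  have [h nh] := not_all_ex_not _ _ nmJ.
  by have [mh nJh] := imply_to_and _ _ nh; exists h.
have [R QsR|h [mh nJh Qsh]] := IH; first by apply: hQ; right.
have [QJ|/not_all_ex_not[p np]] := classic (sub_ideal Q J).
  by exists h; split=> // R [<-|/Qsh]; [left|].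
have [Qp nJp] := imply_to_and _ _ np; exists (p * h); split; first exact: idealMl.
  by case/prJ.
move=> R [<-|QsR]; first by right; apply: idealMr => //; apply: hQ; left.
have [RJ|Rh] := Qsh R QsR; first by left.
by right; apply: idealMl => //; apply: hQ; right.
Qed.

(** If [f] avoids the other primes but lies in [P], it is corrected by an [h] in [m], outside [P],
    that lies in every other prime not contained in [P]. *)
Lemma prime_avoidance m (Ps : seq (S -> Prop)) : is_ideal m ->
  (forall P, List.In P Ps -> is_prime P /\ ~ sub_ideal m P) ->
  exists2 f, m f & forall P, List.In P Ps -> ~ P f.
Proof.
move=> hm; elim: Ps => [_|P Ps IH hPs]; first by exists 0 => //; apply: ideal0.
have [Q PsQ|f mf nf] := IH; first by apply: hPs; right.
have [prP nmP] := hPs P (or_introl erefl); have [hP _ _] := prP.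
have [Pf|nPf] := classic (P f); last by exists f => // Q [<-|/nf].
have [Q PsQ|h [mh nPh Ph]] := prime_avoids_ideals prP hm nmP (Qs := Ps).
  by have [|[]] := hPs Q; first by right.
exists (f + h) => [|Q [<-|PsQ]]; first exact: idealD.
  by move/(idealDl hP Pf).
have [QP|Qh] := Ph Q PsQ; first by move/QP/(idealDl hP Pf).
by have [|[hQ _ _] _] := hPs Q; [right | move/(idealDr hQ Qh); apply: nf].
Qed.

Lemma zero_divisor_primes I : noetherian -> is_ideal I ->
  exists Ps : seq (S -> Prop),
    (forall P, List.In P Ps -> is_prime P /\ exists2 u, ~ I u & P = colon I u) /\
    (forall f, ~ regular_on I f -> exists2 P, List.In P Ps & P f).
Proof.
move=> noeth hI; have [s [smax maxs]] := noetherian_fin_gen noeth (max_colon I).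
exists [seq colon I u | u <- s]; split.
  move=> P /In_map[u /smax maxu ->]; split; first exact: max_colon_prime.
  by exists u => //; case: maxu.
move=> f /not_all_ex_not[u nregf]; have [Ifu nIu] := imply_to_and _ _ nregf.
have [v maxv uv] := max_colon_exists noeth hI nIu.
have [nIv _] := maxv; have prv := max_colon_prime hI maxv.
have [_ nv1 _] := prv.
(* Were no listed annihilator contained in that of [v], primality would give an [h] outside the
   latter but in all listed ones; such an [h] kills all of [s], hence also [v]. *)
have [|||h [_ nvh hQ]] := @prime_avoids_ideals _ (fun=> True) [seq colon I u | u <- s] prv.
- by split.
- by move=> /(_ 1 Logic.I).
- by move=> Q /In_map[w _ ->]; apply: is_ideal_colon.
have [[w [sw wv]]|nw] := classic (exists w, w \in s /\ sub_ideal (colon I w) (colon I v)).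
  exists (colon I w); first by apply/In_map; exists w.
  by have [_ maxw] := smax w sw; apply: (maxw v) => //; apply: uv.
case: nvh; rewrite /colon mulrC.
apply: (ideal_gen_sub (is_ideal_colon h hI)) (maxs _ maxv) => w sw.
have [|wv|] := hQ (colon I w); first by apply/In_map; exists w.
  by case: nw; exists w.
by rewrite /colon mulrC.
Qed.

Definition socle_elt m I u := ~ I u /\ forall z, m z -> I (z * u).

(** If an associated prime [colon I u] contained [m], then [u] would be a socle element. So prime
    avoidance applies to the associated primes of all the ideals at once. *)
Lemma common_regular_element m (Is : seq (S -> Prop)) : noetherian -> is_ideal m ->
  (forall I, List.In I Is -> is_ideal I /\ ~ exists u, socle_elt m I u) ->
  exists2 f, m f & forall I, List.In I Is -> regular_on I f.
Proof.
move=> noeth hm hIs.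
have [Ps [prPs coverPs]] : exists Ps : seq (S -> Prop),
    (forall P, List.In P Ps -> is_prime P /\ ~ sub_ideal m P) /\
    (forall I, List.In I Is -> forall f, ~ regular_on I f -> exists2 P, List.In P Ps & P f).
  elim: Is hIs => [_|I Is IH hIs]; first by exists [::].
  have [J IsJ|Ps [prPs coverPs]] := IH; first by apply: hIs; right.
  have [hI nsoc] := hIs I (or_introl erefl).
  have [Qs [prQs coverQs]] := zero_divisor_primes noeth hI.
  exists (Qs ++ Ps); split=> [P|J IsJ f].
    move/List.in_app_iff => [/prQs[prP [u nIu defP]]|/prPs//]; split=> // mP.
    by apply: nsoc; exists u; split=> // z /mP; rewrite defP.
  case: IsJ => [<-/coverQs|IsJ /(coverPs _ IsJ)] [P inP Pf]; exists P => //.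
    by apply/List.in_app_iff; left.
  by apply/List.in_app_iff; right.
have [f mf nPf] := prime_avoidance hm prPs; exists f => // I IsI.
apply: NNPP => /(coverPs I IsI)[P PsP Pf].
exact: nPf PsP Pf.
Qed.

End Ideals.

(** * Depth *)

Section SocleDepth.
Variables (S : comNzRingType) (m : S -> Prop).
Hypotheses (noeth : noetherian S) (hm : is_ideal m).
Implicit Types (I J A B C : S -> Prop).

(* A regular sequence of length k in m whose quotient has a nonzero element killed
   by m; by [socle_depth_quot] this says that depth S/I = k. *)
Fixpoint socle_depth (k : nat) I : Prop :=
  match k with
  | 0 => exists u, socle_elt m I u
  | k'.+1 => exists f, [/\ m f, regular_on I f & socle_depth k' (ideal_add I f)]
  end.

Lemma socle_depthS_no_socle k I : socle_depth k.+1 I -> ~ socle_depth 0 I.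
Proof. by move=> [f [mf regf _]] [u [nIu /(_ f mf)/regf]]. Qed.

(** If g u = a + w f with a in [I], then [w] takes over the role of [u]. This is the elementary form
    of the fact that both socles are isomorphic to Ext^1(S/m, S/I). *)
Lemma socle_exchange I f g : is_ideal I -> m f -> m g ->
  regular_on I f -> regular_on I g ->
  socle_depth 0 (ideal_add I f) -> socle_depth 0 (ideal_add I g).
Proof.
move=> hI mf mg regf regg [u [nIu socu]].
have [a [w [Ia gu]]] := socu g mg.
exists w; split=> [[b [s [Ib defw]]]|z mz].
  apply: nIu; exists (u - s * f), s; split; last by ring.
  apply: regg; have -> : g * (u - s * f) = a + f * b.
    by rewrite mulrBr gu defw; ring.
  by apply: idealD => //; apply: idealMl.
have [b [t [Ib zu]]] := socu z mz.
exists (z * w - t * g), t; split; last by ring.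
apply: regf; have -> : f * (z * w - t * g) = g * b - z * a.
  have -> : g * b = g * (z * u) - g * (t * f) by rewrite zu; ring.
  by rewrite mulrCA gu; ring.
by apply: idealB => //; apply: idealMl.
Qed.

(** From f u = a + w h, regularity of [h] gives w = b + t f with b in [I]; then f (u - t h) lies in
    [I], so u - t h does. *)
Lemma regular_swap I f h : is_ideal I ->
  regular_on I f -> regular_on (ideal_add I f) h ->
  regular_on (ideal_add I h) f.
Proof.
move=> hI regf regh u [a [w [Ia fu]]].
have [b [t [Ib defw]]] : ideal_add I f w.
  apply: regh; exists (- a), u; split; last by rewrite mulrC [u * f]mulrC fu; ring.
  by rewrite -mulN1r; apply: idealMl.
exists (u - t * h), t; split; last by ring.
apply: regf; have -> : f * (u - t * h) = a + h * b by rewrite mulrBr fu defw; ring.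
by apply: idealD => //; apply: idealMl.
Qed.

(** The depth drops by one whichever regular element is factored out. The given [f] and the [g]
    provided by the hypothesis are compared through an [h] regular modulo [I], I + (f) and I + (g):
    the induction hypothesis is used for I + (g) with [h], then for I + (h) with [f]. *)
Lemma socle_depth_quot k I f : is_ideal I -> m f -> regular_on I f ->
  socle_depth k.+1 I -> socle_depth k (ideal_add I f).
Proof.
elim: k I f => [|k IH] I f hI mf regf dI.
  by have [g [mg regg dg]] := dI; apply: socle_exchange dg.
have [g [mg regg dg]] := dI.
have hIf := is_ideal_add f hI; have hIg := is_ideal_add g hI.
have nsoc := socle_depthS_no_socle dI; have nsocg := socle_depthS_no_socle dg.
have nsocf : ~ socle_depth 0 (ideal_add I f).
  by move/(socle_exchange hI mf mg regf regg).
have [h mh regh] : exists2 h, m h & forall J,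
    List.In J [:: I; ideal_add I f; ideal_add I g] -> regular_on J h.
  by apply: common_regular_element => // J /= [<-|[<-|[<-|[]]]].
have reghI : regular_on I h by apply: regh; left.
have reghf : regular_on (ideal_add I f) h by apply: regh; right; left.
have reghg : regular_on (ideal_add I g) h by apply: regh; right; right; left.
exists h; split=> //; rewrite ideal_addC; apply: (IH) => //.
- exact: is_ideal_add.
- exact: regular_swap.
exists g; split=> //; first exact: regular_swap.
by rewrite ideal_addC; apply: IH.
Qed.

(** Without a socle there is a regular element in [m], and it enlarges [I] strictly, since by
    regularity it lies in [I] only if 1 does. By the chain condition this ends, at an ideal with a
    socle. *)
Lemma socle_depth_exists I : is_ideal I -> sub_ideal I m -> ~ m 1 ->
  exists k, socle_depth k I.
Proof.
move=> hI Im nm1; have acc := noeth hI; elim: acc hI Im => {}I _ IH hI Im.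
have [soc|nsoc] := classic (exists u, socle_elt m I u); first by exists 0%N.
have [f mf regf] : exists2 f, m f & forall J, List.In J [:: I] -> regular_on J f.
  by apply: common_regular_element => // J /= [<-|[]].
have {}regf : regular_on I f by apply: regf; left.
have [|||k dk] := IH (ideal_add I f).
- split; [exact: is_ideal_add|exact: sub_ideal_add|exists f].
    by rewrite -[X in ideal_add _ _ X]mul1r; apply: ideal_add_mem.
  by move=> If; apply/nm1/Im/regf; rewrite mulr1.
- exact: is_ideal_add.
- exact: ideal_add_min.
by exists k.+1, f.
Qed.

(** Every term of a regular sequence in [m] lowers [k] by one, by [socle_depth_quot], and at 0 the
    socle element rules out a further term. *)
Lemma socle_depth_is_depth k I : is_ideal I -> socle_depth k I -> is_depth m I k.
Proof.
move=> hI dk; split.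
  elim: k I hI dk => [|k IH] I hI.
    move=> [u [nIu _]]; exists [::]; split=> //= I1.
    by apply: nIu; rewrite -[u]mulr1; apply: idealMl.
  move=> [f [mf regf /(IH _ (is_ideal_add f hI))[s [ms regs <-]]]].
  exists (f :: s); split=> // g; rewrite inE => /predU1P[->//|/ms//].
move=> s; elim: s k I hI dk => [//|f s IH] k I hI dk ms /= [regf regs].
have mf : m f by apply: ms; rewrite inE eqxx.
case: k dk => [[u [nIu /(_ f mf)/regf]]//|k dk].
apply: IH regs => [||g gs].
- exact: is_ideal_add.
- exact: socle_depth_quot.
- by apply: ms; rewrite inE gs orbT.
Qed.

(** If x = a + s f = b + t f, then (t - s) f is in A + B, so t - s = a' + b' by regularity. Then a -
    a' f = b + b' f lies in both ideals and differs from x by a multiple of f. *)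
Lemma ideal_add_cap A B f : is_ideal A -> is_ideal B -> regular_on (ideal_sum A B) f ->
  ideal_cap (ideal_add A f) (ideal_add B f) = ideal_add (ideal_cap A B) f.
Proof.
move=> hA hB regf; apply: ideal_ext; last first.
  by move=> _ [a [s [[Aa Ba] ->]]]; split; exists a, s.
move=> x [[a [s [Aa defx]]] [b [t [Bb]]]]; rewrite defx => eqab.
have [|a' [b' [Aa' Bb' ts]]] := regf (t - s).
  exists a, (-1 * b); split=> //; first exact: idealMl.
  have -> : a = b + t * f - s * f by rewrite -eqab; ring.
  by ring.
have defaf : a - a' * f = b + b' * f.
  have -> : a = b + (t - s) * f by rewrite mulrBl addrA -eqab; ring.
  by rewrite ts; ring.
exists (a - a' * f), (s + a'); split; last by ring.
split; first by apply: idealB => //; apply: idealMr.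
by rewrite defaf; apply: idealD => //; apply: idealMr.
Qed.

Lemma ideal_add_sum A B f : is_ideal A -> is_ideal B ->
  ideal_sum (ideal_add A f) (ideal_add B f) = ideal_add (ideal_sum A B) f.
Proof.
move=> hA hB; apply: ideal_ext.
  move=> _ [_ [_ [[a [s [Aa ->]]] [b [t [Bb ->]]] ->]]].
  by exists (a + b), (s + t); split; [exists a, b | ring].
move=> _ [_ [s [[a [b [Aa Bb ->]]] ->]]].
exists (a + s * f), b; split; [by exists a, s | by apply: sub_ideal_add | ring].
Qed.

Lemma regular_cap A B f : regular_on A f -> regular_on B f -> regular_on (ideal_cap A B) f.
Proof. by move=> rA rB u [Au Bu]; split; [apply: rA | apply: rB]. Qed.

Lemma socle_cap A B C : is_ideal A -> is_ideal B ->
    sub_ideal B C -> sub_ideal C (ideal_sum A B) ->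
    ~ socle_depth 0 C -> socle_depth 0 B ->
  socle_depth 0 (ideal_cap A B).
Proof.
move=> hA hB BC CAB nC [u [nBu socu]].
have [|a [b [Aa Bb defu]]] := CAB u.
  (* If [u] were not in [C], it would be a socle element for [C]. *)
  by apply: NNPP => nCu; apply: nC; exists u; split=> // z /socu/BC.
have nBa : ~ B a by move=> Ba; apply: nBu; rewrite defu; apply: idealD.
exists a; split=> [[]//|z mz]; split; first exact: idealMl.
have -> : z * a = z * u - z * b by rewrite defu; ring.
by apply: idealB => //; [apply: socu | apply: idealMl].
Qed.

(* Replaces the long exact sequence of
   0 -> S/(A cap B) -> S/A + S/B -> S/(A + B) -> 0; the ideal C makes the map
   from the socle of S/B to S/(A + B) vanish. *)
Lemma socle_depth_cap p d A B C :
    is_ideal A -> is_ideal B -> is_ideal C ->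
    sub_ideal B C -> sub_ideal C (ideal_sum A B) ->
    socle_depth p.+1 A -> socle_depth p.+1 C -> socle_depth p (ideal_sum A B) ->
    socle_depth d B ->
  socle_depth (minn d p.+1) (ideal_cap A B).
Proof.
elim: p d A B C => [|p IH] [|d] A B C hA hB hC BC CAB dA dC dAB dB.
- by rewrite min0n; apply: (socle_cap hA hB BC CAB (socle_depthS_no_socle dC)).
- have [f mf regf] : exists2 f, m f & forall J, List.In J [:: A; B] -> regular_on J f.
    apply: common_regular_element => // J /= [<-|[<-|[]]]; split=> //.
      exact: socle_depthS_no_socle dA.
    exact: socle_depthS_no_socle dB.
  have {regf} [rA rB] : regular_on A f /\ regular_on B f.
    by split; apply: regf; [left | right; left].
  have [u [nu socu]] := dAB; have [a [b [Aa Bb fu]]] := socu f mf.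
  rewrite minnSS minn0; exists f; split=> //; first exact: regular_cap.
  (* If a = c + e f with c in the intersection, then f e is in [A] and f (u - e) = b + c is in [B];
     cancelling [f] puts [u] in A + B, a contradiction. *)
  exists a; split=> [[c [e [[Ac Bc] defa]]]|z mz].
    apply: nu; exists e, (u - e); split; [| |by ring].
      apply: rA; have -> : f * e = a - c by rewrite defa; ring.
      exact: idealB.
    apply: rB; have -> : f * (u - e) = b + c by rewrite mulrBr fu defa; ring.
    exact: idealD.
  have [a' [b' [Aa' Bb' zu]]] := socu z mz.
  (* With z u = a' + b', multiplying by [f] gives z a - f a' = f b' - z b, an element of both
     ideals. *)
  exists (z * a - f * a'), a'; split; last by ring.
  split; first by apply: idealB => //; apply: idealMl.
  have -> : z * a - f * a' = f * b' - z * b.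
    have -> : a = f * u - b by rewrite fu; ring.
    have -> : b' = z * u - a' by rewrite zu; ring.
    by ring.
  by apply: idealB => //; apply: idealMl.
- by rewrite min0n; apply: (socle_cap hA hB BC CAB (socle_depthS_no_socle dC)).
have hAB := is_ideal_sum hA hB.
have [f mf regf] : exists2 f, m f & forall J,
    List.In J [:: A; B; C; ideal_sum A B] -> regular_on J f.
  apply: common_regular_element => // J /= [<-|[<-|[<-|[<-|[]]]]]; split=> //.
  - exact: socle_depthS_no_socle dA.
  - exact: socle_depthS_no_socle dB.
  - exact: socle_depthS_no_socle dC.
  - exact: socle_depthS_no_socle dAB.
have rA : regular_on A f by apply: regf; left.
have rB : regular_on B f by apply: regf; right; left.
have rC : regular_on C f by apply: regf; right; right; left.
have rAB : regular_on (ideal_sum A B) f by apply: regf; right; right; right; left.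
rewrite minnSS; exists f; split=> //; first exact: regular_cap.
rewrite -ideal_add_cap //; apply: (IH _ _ _ (ideal_add C f)).
- exact: is_ideal_add.
- exact: is_ideal_add.
- exact: is_ideal_add.
- exact: ideal_add_mono.
- by rewrite ideal_add_sum //; apply: ideal_add_mono.
- exact: socle_depth_quot.
- exact: socle_depth_quot.
- by rewrite ideal_add_sum //; apply: socle_depth_quot.
- exact: socle_depth_quot.
Qed.

(** When [B] itself has depth p + 1, it can serve as its own [C]. *)
Lemma socle_depth_cap_eq p A B : is_ideal A -> is_ideal B ->
    socle_depth p.+1 A -> socle_depth p.+1 B -> socle_depth p (ideal_sum A B) ->
  socle_depth p.+1 (ideal_cap A B).
Proof.
move=> hA hB dA dB dAB; rewrite -[p.+1]minnn.
apply: (socle_depth_cap (C := B)) => // x Bx.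
by exists 0, x; split=> //; [apply: ideal0 | rewrite add0r].
Qed.

End SocleDepth.

(** * The Hilbert basis theorem *)

(** An inaccessible element has an inaccessible predecessor; dependent choice iterates this. *)
Lemma dependent_chain (T : Type) (R : T -> T -> Prop) (x : T) :
  ~ Acc R x -> exists a : nat -> T, forall i, R (a i.+1) (a i).
Proof.
move=> nacc; pose U := {y : T | ~ Acc R y}.
have next (y : U) : {z : U | R (sval z) (sval y)}.
  case: y => y nacy; apply: constructive_indefinite_description.
  apply: NNPP => none; apply: (nacy); constructor => z Rzy.
  by apply: NNPP => nacz; apply: none; exists (exist _ z nacz).
exists (fun i => sval (iter i (fun y => sval (next y)) (exist _ x nacc))) => i /=.
by case: (next _).
Qed.

(** Each index is chosen to minimise [b] on the tail that starts just after the previous one. *)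
Lemma monotone_subsequence (b : nat -> nat) :
  exists h : nat -> nat,
    {homo h : i j / (i < j)%N} /\ {homo (fun i => b (h i)) : i j / (i <= j)%N}.
Proof.
have tail_min n : {g : nat | (n <= g)%N /\ forall j, (n <= j)%N -> (b g <= b j)%N}.
  apply: constructive_indefinite_description.
  have [k] : exists k, (b n <= k)%N by exists (b n).
  move: (leqnn n); move: {2 3}n => i.
  elim: k i => [|k IH] i ni ki.
    by exists i; split=> // j _; apply: leq_trans ki _.
  have [[j [nj bj]]|none] := classic (exists j, (n <= j)%N /\ (b j < b i)%N).
    by apply: (IH j) => //; rewrite -ltnS; apply: leq_trans ki.
  exists i; split=> // j nj; rewrite leqNgt; apply/negP => bj.
  by apply: none; exists j.
pose h k := iter k (fun i => sval (tail_min i.+1)) (sval (tail_min 0%N)).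
have hS k : (h k < h k.+1)%N by rewrite /=; case: (tail_min _) => ? [].
have hmin k j : (h k <= j)%N -> (b (h k) <= b j)%N.
  by case: k => [|k] /=; case: (tail_min _) => g /= [ng bg] /(leq_trans ng)/bg.
exists h; split; first exact: (homo_ltn ltn_trans).
by apply: (homo_leq leqnn leq_trans) => k; apply: hmin; apply: ltnW.
Qed.

(** Subsequences are refined one coordinate at a time until all coordinates are monotone; the first
    two terms then suffice. *)
Lemma dickson n (a : nat -> 'X_{1..n}) : exists i j, (i < j)%N /\ (a i <= a j)%MM.
Proof.
suff [h [hmono ah]] : exists h : nat -> nat, {homo h : i j / (i < j)%N} /\
    forall c, c \in enum 'I_n -> {homo (fun i => a (h i) c) : i j / (i <= j)%N}.
  exists (h 0%N), (h 1%N); split; first exact: hmono.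
  by apply/mnm_lepP => c; apply: ah; rewrite ?mem_enum.
elim: (enum _) => [|c cs [h [hmono ah]]]; first by exists id; split.
have [g [gmono bg]] := monotone_subsequence (fun i => a (h i) c).
exists (fun i => h (g i)); split=> [i j /gmono/hmono//|c'].
rewrite inE => /predU1P[->//|/ah mono i j le_ij]; apply: mono.
by move: le_ij; rewrite leq_eqVlt => /predU1P[->//|/gmono/ltnW].
Qed.

(* In a strictly ascending chain choose f_i in I_(i+1) \ I_i with the smallest
   possible leading monomial; by Dickson's lemma lm(f_i) divides lm(f_j) for some
   i < j, and cancelling the leading term of f_j contradicts minimality. *)
Lemma noetherian_mpoly (K : fieldType) n : noetherian {mpoly K[n]}.
Proof.
move=> I0 hI0; apply: NNPP => nacc.
have [I chain] := dependent_chain nacc.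
have hI i : is_ideal (I i.+1) by case: (chain i).
have ascending i j : (i <= j)%N -> sub_ideal (I i) (I j).
  elim: j => [|j IH]; first by rewrite leqn0 => /eqP ->.
  rewrite leq_eqVlt ltnS => /predU1P[-> //|/IH sub] x /sub.
  by case: (chain j) => _ le _ /le.
have min_elt i : {f | [/\ I i.+1 f, ~ I i f &
    forall g, I i.+1 g -> ~ I i g -> ~ (mlead g < mlead f)%O]}.
  apply: constructive_indefinite_description.
  have [_ _ [f If nIf]] := chain i.
  move: f If nIf; apply: mleadrect => f IH If nIf.
  have [[g [Ig nIg lt_gf]]|none] := classic
      (exists g, [/\ I i.+1 g, ~ I i g & (mlead g < mlead f)%O]).
    exact: (IH g).
  by exists f; split=> // g Ig nIg lt_gf; apply: none; exists g.
have [F minF] : exists F : nat -> {mpoly K[n]}, forall i, [/\ I i.+1 (F i), ~ I i (F i) &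
    forall g, I i.+1 g -> ~ I i g -> ~ (mlead g < mlead (F i))%O].
  by exists (fun i => sval (min_elt i)) => i; case: (min_elt i).
(* The shift by one is needed because the chain certifies as ideals only its members from [I 1]
   on. *)
have [i [j [lt_ij]]] := dickson (fun i => mlead (F i.+1)).
have [If nIf _] := minF i.+1; have [Ig nIg ming] := minF j.+1.
move: (F i.+1) (F j.+1) If nIf Ig nIg ming => f g If nIf Ig nIg ming le_fg.
have f_neq0 : f != 0 by apply: contra_notN nIf => /eqP ->; apply: ideal0.
have g_neq0 : g != 0 by apply: contra_notN nIg => /eqP ->; apply: ideal0.
(* The multiplier [t] is chosen so that [t * f] and [g] have the same leading term. *)
pose c := mleadc g / mleadc f; pose t := c *: 'X_[mlead g - mlead f].
have c_neq0 : c != 0 by rewrite mulf_neq0 ?invr_eq0 ?mleadc_eq0.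
have t_neq0 : t != 0.
  rewrite scaler_eq0 negb_or c_neq0 -mleadc_eq0 mleadXm mcoeffX eqxx.
  exact: oner_neq0.
have lead_t : mlead t = (mlead g - mlead f)%MM by rewrite mleadZ ?mleadXm.
have lead_tf : mlead (t * f) = mlead g by rewrite mleadM // lead_t submK.
have leadc_tf : (t * f)@_(mlead g) = mleadc g.
  rewrite -[in LHS](submK le_fg) -lead_t mleadcM lead_t mcoeffZ mcoeffX eqxx mulr1.
  by rewrite divfK ?mleadc_eq0.
have Itf k : (i < k)%N -> I k.+1 (t * f).
  by move=> ik; apply: idealMl => //; apply: ascending If.
have nIr : ~ I j.+1 (g - t * f).
  move=> Ir; apply: nIg; rewrite -(subrK (t * f) g); apply: idealD => //.
  exact: Itf.
apply: (ming (g - t * f)) => //.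
  by apply: idealB => //; apply: Itf; apply: ltnW.
have le_rg : (mlead (g - t * f) <= mlead g)%O.
  by rewrite (le_trans (mleadB_le _ _)) // lead_tf joinxx.
(* Leading coefficients cancel, so the leading monomial could stay the same only if the difference
   were 0, which lies in the ideal. *)
rewrite lt_neqAle le_rg andbT; apply/eqP => lead_r; apply: nIr.
suff -> : g - t * f = 0 by apply: ideal0.
by apply/eqP; rewrite -mleadc_eq0 lead_r mcoeffB leadc_tf subrr.
Qed.

(** * Substitutions and ideals of cliques *)

Lemma ideal_gen_eq (S : comNzRingType) (P Q : S -> Prop) :
  (forall f, P f <-> Q f) -> ideal_gen P = ideal_gen Q.
Proof. by move=> PQ; apply: ideal_ext; apply: ideal_gen_mono => f /PQ. Qed.

Lemma ideal_gen_image (S : comNzRingType) (T : finType) (B : {set T}) (G : T -> S) f :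
  ideal_gen (fun g => exists2 j, j \in B & g = G j) f ->
  exists r : T -> S, f = \sum_(j in B) r j * G j.
Proof.
apply: (ideal_gen_sub (I := fun f => exists r : T -> S, f = \sum_(j in B) r j * G j)).
  split.
  - by exists (fun=> 0); rewrite big1 // => j _; rewrite mul0r.
  - move=> _ _ [r ->] [s ->]; exists (fun j => r j + s j).
    by rewrite -big_split; apply: eq_bigr => j _; rewrite mulrDl.
  - move=> t _ [r ->]; exists (fun j => t * r j).
    by rewrite mulr_sumr; apply: eq_bigr => j _; rewrite mulrA.
move=> _ [j jB ->]; exists (fun i => (i == j)%:R).
rewrite (bigD1 j) //= eqxx mul1r big1 ?addr0 // => i /andP[_ /negPf ->].
by rewrite mul0r.
Qed.

Lemma ideal_preimage (S S' : comNzRingType) (s : {rmorphism S -> S'}) (J : S' -> Prop) :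
  is_ideal J -> is_ideal (fun f => J (s f)).
Proof.
move=> hJ; split; first by rewrite rmorph0; apply: ideal0.
- by move=> a b Ja Jb; rewrite rmorphD; apply: idealD.
- by move=> r a Ja; rewrite rmorphM; apply: idealMl.
Qed.

Lemma is_ideal_zero (S : comNzRingType) : is_ideal (fun x : S => x = 0).
Proof.
by split=> [//|a b -> ->|r a ->]; rewrite ?addr0 ?mulr0.
Qed.

Section Substitution.
Variable K : fieldType.

(** The polynomials on which [s] and [t] agree modulo [I] are closed under sums and products, so
    constants and variables suffice. *)
Lemma rmorph_mpoly_congr n (S : comNzRingType) (I : S -> Prop)
    (s t : {rmorphism {mpoly K[n]} -> S}) :
    is_ideal I -> (forall c, s c%:MP = t c%:MP) -> (forall i, I (s 'X_i - t 'X_i)) ->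
  forall f, I (s f - t f).
Proof.
move=> hI stC stX.
have closedM f g : I (s f - t f) -> I (s g - t g) -> I (s (f * g) - t (f * g)).
  move=> If Ig; rewrite !rmorphM.
  have -> : s f * s g - t f * t g = s g * (s f - t f) + t f * (s g - t g) by ring.
  by apply: idealD => //; apply: idealMl.
have closed1 : I (s 1 - t 1) by rewrite !rmorph1 subrr; apply: ideal0.
move=> f; rewrite [f]mpolyE; apply: (big_ind (fun f => I (s f - t f))).
- by rewrite !rmorph0 subrr; apply: ideal0.
- by move=> g h Ig Ih; rewrite !rmorphD opprD addrACA; apply: idealD.
move=> mm _; rewrite -mul_mpolyC; apply: (closedM).
  by rewrite stC subrr; apply: ideal0.
rewrite mpolyXE_id; apply: (big_ind (fun f => I (s f - t f)) closed1 closedM) => i _.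
by elim: (mm i) => [|k IH]; rewrite ?expr0 // exprS; apply: closedM.
Qed.

Definition kill n (i : 'I_n) : {mpoly K[n]} -> {mpoly K[n]} :=
  comp_mpoly [tuple (if j == i then 0 else 'X_j) | j < n].

HB.instance Definition _ n (i : 'I_n) := GRing.RMorphism.on (@kill n i).

Lemma killX n (i j : 'I_n) : kill i 'X_j = if j == i then 0 else 'X_j.
Proof. by rewrite /kill comp_mpolyXU -tnth_nth tnth_mktuple. Qed.

Lemma kill_decomp n (i : 'I_n) f : exists g, f = kill i f + g * 'X_i.
Proof.
suff [a [g [-> defg]]] : ideal_add (fun x => x = 0) 'X_i (f - kill i f).
  by exists g; rewrite -[LHS](subrK (kill i f)) defg add0r addrC.
apply: (@rmorph_mpoly_congr n _ _ idfun (kill i)).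
- exact/is_ideal_add/is_ideal_zero.
- by move=> c; rewrite /= /kill comp_mpolyC.
move=> j /=; rewrite killX; case: eqP => [->|_].
  by exists 0, 1; split=> //; rewrite subr0 mul1r add0r.
by exists 0, 0; split=> //; rewrite subrr mul0r add0r.
Qed.

(** Being fixed by [kill i] expresses that the variable of index [i] does not occur. *)
Definition free_of n (P : {mpoly K[n]} -> Prop) (i : 'I_n) := forall p, P p -> kill i p = p.

(** The polynomials that split in this way form an ideal, and each generator splits with [g] equal
    to 0. *)
Lemma ideal_gen_kill n (P : {mpoly K[n]} -> Prop) i f : free_of P i -> ideal_gen P f ->
  ideal_gen P (kill i f) /\ exists2 g, ideal_gen P g & f = kill i f + g * 'X_i.
Proof.
move=> freeP; have hP := is_ideal_gen P.
apply: (ideal_gen_sub (I := fun f => ideal_gen P (kill i f) /\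
  exists2 g, ideal_gen P g & f = kill i f + g * 'X_i)).
  split.
  - have P0 := ideal0 hP; rewrite rmorph0; split=> //.
    by exists 0 => //; rewrite mul0r add0r.
  - move=> a b [Pa [a' Pa' defa]] [Pb [b' Pb' defb]]; rewrite rmorphD.
    split; first exact: idealD.
    exists (a' + b'); first exact: idealD.
    by rewrite [in LHS]defa [in LHS]defb; ring.
  - move=> r a [Pa [a' Pa' defa]]; rewrite rmorphM; split; first exact: idealMl.
    have [r' defr] := kill_decomp i r.
    exists (r' * kill i a + r * a').
      by apply: idealD => //; apply: idealMl.
    have -> : r * a = (r - r' * 'X_i) * kill i a + (r' * kill i a + r * a') * 'X_i.
      by rewrite [in LHS]defa; ring.
    by rewrite {1}defr addrK.
move=> p Pp; rewrite freeP //; split; first exact: ideal_gen_mem.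
by exists 0; rewrite ?mul0r ?addr0 //; apply: ideal0.
Qed.

Lemma mpolyX_neq0 n (i : 'I_n) : 'X_i != 0 :> {mpoly K[n]}.
Proof. by rewrite -mleadc_eq0 mleadXm mcoeffX eqxx oner_neq0. Qed.

Lemma regular_free_var n (P : {mpoly K[n]} -> Prop) i :
  free_of P i -> regular_on (ideal_gen P) 'X_i.
Proof.
move=> freeP g Pg; have [_ [h Ph]] := ideal_gen_kill freeP Pg.
rewrite rmorphM /= killX eqxx mul0r add0r mulrC.
by move/(mulIf (mpolyX_neq0 i)) => ->.
Qed.

(** Each variable of [s] is absent from the generators present when it is adjoined, hence regular,
    and so accounts for one unit of depth. *)
Lemma socle_depth_vars n (m P Q : {mpoly K[n]} -> Prop) (s : seq 'I_n) k :
    is_ideal m -> uniq s -> (forall i, i \in s -> m 'X_i /\ free_of P i) ->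
    (forall f, Q f <-> P f \/ exists2 i, i \in s & f = 'X_i) ->
  socle_depth m k (ideal_gen Q) -> socle_depth m (k + size s) (ideal_gen P).
Proof.
move=> hm; elim: s P => [|i s IH] P /=.
  move=> _ _ QP; rewrite addn0 (@ideal_gen_eq _ P Q) // => f; split=> [Pf|/QP[//|[]//]].
  by apply/QP; left.
move=> /andP[nsi us] hP QP dQ; rewrite addnS; have [mi freei] := hP i (mem_head _ _).
exists 'X_i; split=> //; first exact: regular_free_var.
rewrite ideal_gen_add; apply: IH us _ _ dQ.
  move=> j sj; have [|mj freej] := hP j; first by rewrite inE sj orbT.
  split=> // p [/freej //|<-]; rewrite killX; case: eqP => // eq_ij.
  by rewrite eq_ij sj in nsi.
move=> f; rewrite QP; split.
  move=> [Pf|[j]]; first by left; left.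
  by rewrite inE => /predU1P[->|sj] ->; [left; right | right; exists j].
move=> [[Pf|<-]|[j sj ->]]; first by left.
  by right; exists i => //; apply: mem_head.
by right; exists j => //; rewrite inE sj orbT.
Qed.

End Substitution.

(** * Ideals of cliques: regular variables and depth *)

Section VertexVariables.
Variables (K : fieldType) (V : finType).
Notation S := {mpoly K[#|V| + #|V|]}.
Notation x := (@xvar K V).
Notation y := (@yvar K V).
Notation m := (@graded_max_ideal K V).
Implicit Types (P Q : S -> Prop) (A B : {set V}).

Definition xidx (u : V) : 'I_(#|V| + #|V|) := lshift #|V| (enum_rank u).
Definition yidx (u : V) : 'I_(#|V| + #|V|) := rshift #|V| (enum_rank u).

Definition minor (u w : V) : S := x u * y w - x w * y u.
(** These generate the binomial edge ideal of the complete graph on [A]; the choices [u = w] only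
    add 0. *)
Definition minors A : S -> Prop := fun f => exists u w, [/\ u \in A, w \in A & f = minor u w].
Definition xvars A : S -> Prop := fun f => exists2 u, u \in A & f = x u.
Definition coords A : S -> Prop := fun f => exists2 u, u \in A & f = x u \/ f = y u.
Definition free_vertex P (a : V) := free_of P (xidx a) /\ free_of P (yidx a).

Lemma is_ideal_max : is_ideal m. Proof. exact: is_ideal_gen. Qed.

Lemma max_x u : m (x u). Proof. by apply: ideal_gen_mem; exists u; left. Qed.
Lemma max_y u : m (y u). Proof. by apply: ideal_gen_mem; exists u; right. Qed.

Lemma one_notin_max : ~ m 1.
Proof.
move=> m1; have /eqP := oner_neq0 K; apply.
rewrite -(rmorph1 (meval (fun=> 0 : K) : {rmorphism S -> K})).
apply: (ideal_gen_sub (ideal_preimage _ (is_ideal_zero K)) _ m1) => f [u].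
by move=> [->|->] /=; rewrite mevalXU.
Qed.

Lemma kill_xx a b : kill (xidx a) (x b) = if b == a then 0 else x b.
Proof. by rewrite killX (inj_eq (@lshift_inj _ _)) (inj_eq enum_rank_inj). Qed.

Lemma kill_yy a b : kill (yidx a) (y b) = if b == a then 0 else y b.
Proof. by rewrite killX (inj_eq (@rshift_inj _ _)) (inj_eq enum_rank_inj). Qed.

Lemma kill_xy a b : kill (xidx a) (y b) = y b.
Proof. by rewrite killX eq_rlshift. Qed.

Lemma kill_yx a b : kill (yidx a) (x b) = x b.
Proof. by rewrite killX eq_lrshift. Qed.

Definition killE := (kill_xx, kill_yy, kill_xy, kill_yx).

Lemma free_or P Q i : free_of P i -> free_of Q i -> free_of (pred_or P Q) i.
Proof. by move=> fP fQ p [/fP|/fQ]. Qed.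

Lemma free_minors A a : a \notin A -> free_vertex (minors A) a.
Proof.
move=> aA; have neq u : u \in A -> (u == a) = false.
  by move=> uA; apply: contraNF aA => /eqP <-.
split=> _ [u [w [uA wA ->]]]; rewrite rmorphB !rmorphM /= !killE !neq //.
Qed.

Lemma free_coords A a : a \notin A -> free_vertex (coords A) a.
Proof.
move=> aA; have neq u : u \in A -> (u == a) = false.
  by move=> uA; apply: contraNF aA => /eqP <-.
by split=> _ [u uA [->|->]]; rewrite killE ?neq.
Qed.

Lemma free_xvars A a : free_of (xvars A) (yidx a).
Proof. by move=> _ [u uA ->]; rewrite killE. Qed.

Lemma free_vertex_or P Q a :
  free_vertex P a -> free_vertex Q a -> free_vertex (pred_or P Q) a.
Proof. by move=> [xP yP] [xQ yQ]; split; apply: free_or. Qed.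

Lemma minors_decomp P A a f : a \in A -> ideal_gen (pred_or P (minors A)) f ->
  exists t (r : V -> S), ideal_gen (pred_or P (minors (A :\ a))) t /\
    f = t + \sum_(j in A :\ a) r j * minor a j.
Proof.
move=> aA gf.
have : ideal_sum (ideal_gen (pred_or P (minors (A :\ a))))
    (ideal_gen (fun g => exists2 j, j \in A :\ a & g = minor a j)) f.
  apply: ideal_gen_sub gf; first by apply: is_ideal_sum; apply: is_ideal_gen.
  rewrite ideal_gen_sum => g Tg; have hT := is_ideal_gen (pred_or
    (pred_or P (minors (A :\ a))) (fun g => exists2 j, j \in A :\ a & g = minor a j)).
  case: Tg => [Pg|[u [w [uA wA ->]]]]; first by apply: ideal_gen_mem; left; left.
  have [->|nua] := eqVneq u a; have [->|nwa] := eqVneq w a.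
  - by rewrite /minor subrr; apply: ideal0.
  - by apply: ideal_gen_mem; right; exists w; rewrite // !inE nwa.
  - have -> : minor u a = -1 * minor a u by rewrite /minor; ring.
    by apply: idealMl => //; apply: ideal_gen_mem; right; exists u; rewrite // !inE nua.
  by apply: ideal_gen_mem; left; right; exists u, w; rewrite !inE nua nwa.
by move=> [t [_ [gt /ideal_gen_image[r ->] ->]]]; exists t, r.
Qed.

(* If x_a g lies in the ideal, write x_a g = t + sum_j r_j minor(a,j) with t not
   involving j = a and put x_a = 0: then y_a sum_j r_j x_j, hence sum_j r_j x_j, and
   by induction also sum_j r_j y_j, lie in the ideal with a removed. *)
Lemma regular_minors P A a : (forall b, b \in A -> free_vertex P b) -> a \in A ->
  regular_on (ideal_gen (pred_or P (minors A))) (x a).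
Proof.
move cardA: #|A| => k; elim: k A cardA a => [|k IH] A cardA a freeP aA.
  by move/cards0_eq: cardA aA => ->; rewrite inE.
move=> g /(minors_decomp aA)[t [r [gt defxg]]].
set A' := A :\ a in gt defxg *; set T' := ideal_gen (pred_or P (minors A')) in gt *.
have aA' : a \notin A' by rewrite !inE eqxx.
have sA' b : b \in A' -> b \in A by rewrite !inE => /andP[].
have cardA' : #|A'| = k by move: cardA; rewrite (cardsD1 a) aA => -[].
have [xfree yfree] : free_vertex (pred_or P (minors A')) a.
  by apply: free_vertex_or; [apply: freeP | apply: free_minors].
have hT' : is_ideal T' := is_ideal_gen _.
have [T't0 [t' T't' deft]] := ideal_gen_kill xfree gt.
set t0 := kill _ t in T't0 deft.
have [r' defr] : exists r' : V -> S, forall j, r j = kill (xidx a) (r j) + r' j * x a.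
  have dec j := constructive_indefinite_description _ (kill_decomp (xidx a) (r j)).
  by exists (fun j => sval (dec j)) => j; apply: (svalP (dec j)).
pose r0 j := kill (xidx a) (r j).
have t0E : t0 = y a * \sum_(j in A') r0 j * x j.
  have := congr1 (kill (xidx a)) defxg; rewrite rmorphM rmorphD rmorph_sum /=.
  rewrite killE eqxx mul0r -/t0 => /esym/eqP; rewrite addr_eq0 => /eqP ->.
  rewrite mulr_sumr -sumrN; apply: eq_bigr => j jA'.
  have /negPf neq_ja : j != a by move: jA'; rewrite !inE => /andP[].
  by rewrite /minor rmorphM rmorphB !rmorphM /= !killE eqxx neq_ja /r0; ring.
have T'sx : T' (\sum_(j in A') r0 j * x j).
  by apply: (regular_free_var yfree); rewrite -t0E.
have T'sy : T' (\sum_(j in A') r0 j * y j).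
  have [->|/set0Pn[b bA']] := eqVneq A' set0; first by rewrite big_set0; apply: ideal0.
  apply: (IH A' cardA' b _ bA') => [c /sA'/freeP//|].
  (* This trades the x_j for the y_j at the cost of minors on A'; [x b] is then cancelled by the
     induction hypothesis. *)
  have -> : x b * (\sum_(j in A') r0 j * y j) =
      y b * (\sum_(j in A') r0 j * x j) + \sum_(j in A') r0 j * minor b j.
    rewrite !mulr_sumr -big_split /=; apply: eq_bigr => j _.
    by rewrite /minor; ring.
  apply: idealD => //; first exact: idealMl.
  rewrite -big_filter; apply: ideal_sumr => // j.
  rewrite mem_filter => /andP[jA' _]; apply: idealMl => //.
  by apply: ideal_gen_mem; right; exists b, j.
have hT := is_ideal_gen (pred_or P (minors A)).
have T'T : sub_ideal T' (ideal_gen (pred_or P (minors A))).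
  apply: ideal_gen_mono => p [Pp|[u [w [/sA' uA /sA' wA ->]]]]; first by left.
  by right; exists u, w.
(* After splitting [t] and the [r j] by powers of x_a, the two terms in y_a cancel, and x_a can be
   divided out of what remains. *)
have -> : g = t' + \sum_(j in A') r0 j * y j + \sum_(j in A') r' j * minor a j.
  apply: (mulfI (mpolyX_neq0 _ _ : x a != 0)); rewrite defxg deft t0E.
  have -> : \sum_(j in A') r j * minor a j =
      x a * (\sum_(j in A') r0 j * y j) - y a * (\sum_(j in A') r0 j * x j) +
      x a * (\sum_(j in A') r' j * minor a j).
    rewrite !mulr_sumr -sumrB -big_split /=; apply: eq_bigr => j _.
    by rewrite /minor {1}defr -/(r0 j); ring.
  by rewrite /x -/(xidx a); ring.
apply: idealD => //; first by apply: idealD => //; apply: T'T.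
rewrite -big_filter; apply: ideal_sumr => // j.
rewrite mem_filter => /andP[/sA' jA _]; apply: idealMl => //.
by apply: ideal_gen_mem; right; exists a, j.
Qed.

(** An element of the first ideal is t + q y_a with t in T + (x_a). If it is also in the second, so
    is q, because y_a is regular there; and x_u y_a = y_u x_a - minor(a,u) brings q y_a back into T
    + (x_a). *)
Lemma minors_add_x_cap P A a : (forall b, b \in A -> free_vertex P b) -> a \in A ->
  ideal_cap (ideal_gen (pred_or (pred_or P (coords [set a])) (minors (A :\ a))))
            (ideal_gen (pred_or P (xvars A))) =
  ideal_add (ideal_gen (pred_or P (minors A))) (x a).
Proof.
move=> freeP aA; set E1 := ideal_gen _; set E2 := ideal_gen _; set T := ideal_gen _.
have hE1 : is_ideal E1 := is_ideal_gen _; have hE2 : is_ideal E2 := is_ideal_gen _.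
have hT : is_ideal T := is_ideal_gen _; have hTx := is_ideal_add (x a) hT.
have Tx : ideal_add T (x a) (x a) by rewrite -{2}[x a]mul1r; apply: ideal_add_mem.
have xE2 u : u \in A -> E2 (x u) by move=> uA; apply: ideal_gen_mem; right; exists u.
have TE2 : sub_ideal (ideal_add T (x a)) E2.
  apply: ideal_add_min => //; last exact: xE2.
  apply: ideal_gen_sub => // p [Pp|[u [w [uA wA ->]]]]; first by apply: ideal_gen_mem; left.
  by apply: idealB => //; apply: idealMr => //; apply: xE2.
apply: ideal_ext => f.
  move=> [E1f E2f].
  have : ideal_add (ideal_add T (x a)) (y a) f.
    apply: ideal_gen_sub E1f; first exact: is_ideal_add.
    move=> p [[Pp|[u]]|[u [w []]]].
    - by apply/sub_ideal_add/sub_ideal_add/ideal_gen_mem; left.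
    - rewrite inE => /eqP -> [->|->]; first exact: sub_ideal_add.
      by rewrite -{2}[y a]mul1r; apply: ideal_add_mem.
    - rewrite !inE => /andP[_ uA] /andP[_ wA] ->.
      by apply/sub_ideal_add/sub_ideal_add/ideal_gen_mem; right; exists u, w.
  move=> [t [q [Tt deff]]]; rewrite deff; apply: idealD => //.
  have freeE2 : free_of (pred_or P (xvars A)) (yidx a).
    by apply: free_or; [case: (freeP a aA) | apply: free_xvars].
  have E2q : E2 q.
    apply: (regular_free_var freeE2); rewrite mulrC; apply: (idealDl hE2 (TE2 t Tt)).
    by rewrite -deff.
  have := ideal_gen_sub (is_ideal_colon (y a) hTx) _ E2q; apply=> p [Pp|[u uA ->]].
    by apply: idealMr => //; apply/sub_ideal_add/ideal_gen_mem; left.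
  have -> : colon (ideal_add T (x a)) (y a) (x u) =
      ideal_add T (x a) (y u * x a - minor a u).
    by rewrite /colon /minor; congr (ideal_add _ _ _); ring.
  apply: idealB => //; first exact: ideal_add_mem.
  by apply/sub_ideal_add/ideal_gen_mem; right; exists a, u.
move=> Tf; split; last exact: TE2.
have coordE1 u : u = a -> E1 (x u) /\ E1 (y u).
  by move=> ->; split; apply: ideal_gen_mem; left; right; exists a;
    rewrite ?inE; [|left|by []|right].
apply: (ideal_add_min hE1 _ _ Tf); last by case: (coordE1 a).
apply: ideal_gen_sub => // p [Pp|[u [w [uA wA ->]]]].
  by apply: ideal_gen_mem; left; left.
have [/coordE1[E1x E1y]|nua] := eqVneq u a.
  by apply: idealB => //; [apply: idealMr | apply: idealMl].
have [/coordE1[E1x E1y]|nwa] := eqVneq w a.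
  by apply: idealB => //; [apply: idealMl | apply: idealMr].
by apply: ideal_gen_mem; right; exists u, w; rewrite !inE nua nwa.
Qed.

Lemma socle_depth_yvars P Q A k :
    (forall b, b \in A -> free_of P (yidx b)) ->
    (forall f, Q f <-> P f \/ exists2 b, b \in A & f = y b) ->
  socle_depth m k (ideal_gen Q) -> socle_depth m (k + #|A|) (ideal_gen P).
Proof.
move=> freeP QP dQ; rewrite cardE -(size_map yidx).
apply: socle_depth_vars dQ => //; first exact: is_ideal_max.
- rewrite map_inj_uniq ?enum_uniq // => u w /rshift_inj; exact: enum_rank_inj.
- move=> i /mapP[b]; rewrite mem_enum => bA ->; split; [exact: max_y | exact: freeP].
move=> f; rewrite QP; split=> [[Pf|[b bA ->]]|[Pf|[i /mapP[b]]]]; first by left.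
- by right; exists (yidx b) => //; apply: map_f; rewrite mem_enum.
- by left.
by rewrite mem_enum => bA -> ->; right; exists b.
Qed.

(** Induction on the size of [A]. After adding x_a, the ideal is an intersection as in
    [minors_add_x_cap]; its two members have depth k + #|A|, by induction and by counting the free
    y's, and their sum has one less, since y_a is added too. *)
Lemma socle_depth_clique P A k :
    A != set0 -> (forall b, b \in A -> free_vertex P b) ->
    socle_depth m k (ideal_gen (pred_or P (coords A))) ->
  socle_depth m (k + #|A|).+1 (ideal_gen (pred_or P (minors A))).
Proof.
move cardA: #|A| => c; elim: c A P cardA => [|c IH] A P cardA A_neq0 freeP dP.
  by rewrite -cards_eq0 cardA in A_neq0.
have [a aA] := set0Pn _ A_neq0.
set A' := A :\ a.
have cardA' : #|A'| = c by move: cardA; rewrite (cardsD1 a) aA => -[].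
have hm := is_ideal_max.
have [A'0|A'_neq0] := eqVneq A' set0.
  have A1 : A = [set a] by rewrite -(setD1K aA) -/A' A'0 setU0.
  have -> : c = 0%N by rewrite -cardA' A'0 cards0.
  have -> : ideal_gen (pred_or P (minors A)) = ideal_gen P.
    apply: ideal_ext; last by apply: ideal_gen_mono; left.
    apply: ideal_gen_sub; first exact: is_ideal_gen.
    move=> p [/ideal_gen_mem//|[u [w []]]].
    rewrite A1 !inE => /eqP -> /eqP -> ->; rewrite /minor subrr.
    exact: (ideal0 (is_ideal_gen _)).
  have [xfree yfree] := freeP a aA.
  (* For a single vertex all minors vanish, and x_a and y_a are two free variables. *)
  rewrite addn1 -addn2 -[2%N]/(size [:: xidx a; yidx a]).
  apply: socle_depth_vars dP => //.
  - by rewrite /= inE andbT eq_lrshift.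
  - by move=> i; rewrite !inE => /orP[] /eqP ->; split=> //; [apply: max_x | apply: max_y].
  move=> f; rewrite A1; split=> [[Pf|[u]]|[Pf|[i]]]; first by left.
  - rewrite inE => /eqP -> [->|->]; right; [exists (xidx a)|exists (yidx a)];
      by rewrite ?inE ?eqxx ?orbT.
  - by left.
  rewrite !inE => /orP[] /eqP -> ->; right; exists a; rewrite ?inE //; [by left|by right].
exists (x a); split; [exact: max_x | exact: regular_minors |].
rewrite -minors_add_x_cap // -/A' addnS.
have sA' b : b \in A' -> b \in A /\ b != a by rewrite !inE => /andP[].
have hnoeth := @noetherian_mpoly K (#|V| + #|V|).
have AE b : (b \in A) = (b == a) || (b \in A') by rewrite -(setD1K aA) -/A' !inE.
apply: socle_depth_cap_eq => //; try exact: is_ideal_gen.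
- apply: IH => //.
    move=> b /sA'[bA nba]; apply: free_vertex_or; first exact: freeP.
    by apply: free_coords; rewrite inE.
  rewrite (@ideal_gen_eq _ _ (pred_or P (coords A))) // => f; split.
    move=> [[Pf|[u]]|[u /sA'[uA _] fu]]; [by left| |by right; exists u].
    by rewrite inE => /eqP -> fa; right; exists a.
  move=> [Pf|[u]]; first by left; left.
  rewrite AE => /orP[/eqP ->|uA'] fu; last by right; exists u.
  by left; right; exists a; rewrite ?inE.
- rewrite -addnS -cardA; apply: (socle_depth_yvars _ _ dP) => [b bA|f].
    by apply: free_or; [case: (freeP b bA) | apply: free_xvars].
  split; first by move=> [Pf|[u uA [->|->]]]; [left; left|left; right; exists u|right; exists u].
  move=> [[Pf|[u uA ->]]|[u uA ->]]; first by left.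
    by right; exists u => //; left.
  by right; exists u => //; right.
have -> : ideal_sum (ideal_gen (pred_or (pred_or P (coords [set a])) (minors A')))
    (ideal_gen (pred_or P (xvars A))) =
    ideal_gen (pred_or (pred_or P (xvars A)) (eq (y a))).
  rewrite ideal_gen_sum; apply: ideal_ext; last first.
    apply: ideal_gen_mono => p [[Pp|xp]|<-]; [by right; left|by right; right|].
    by left; left; right; exists a; rewrite ?inE //; right.
  set E := ideal_gen (pred_or (pred_or P _) _).
  have hE : is_ideal E := is_ideal_gen _.
  have Ex u : u \in A -> E (x u).
    by move=> uA; apply: ideal_gen_mem; left; right; exists u.
  apply: ideal_gen_sub => // p [[[Pp|[u]]|[u [w [/sA'[uA _] /sA'[wA _] ->]]]]|Pxp].
  - by apply: ideal_gen_mem; left; left.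
  - rewrite inE => /eqP -> [->|->]; first exact: Ex.
    by apply: ideal_gen_mem; right.
  - by apply: idealB => //; apply: idealMr => //; apply: Ex.
  by apply: ideal_gen_mem; left.
rewrite -cardA'; apply: (socle_depth_yvars _ _ dP) => [b /sA'[bA nba]|f].
  apply: free_or; first by apply: free_or; [case: (freeP b bA) | apply: free_xvars].
  by move=> _ <-; rewrite killE eq_sym (negPf nba).
split.
  move=> [Pf|[u uA [->|->]]]; [by left; left; left|by left; left; right; exists u|].
  by move: uA; rewrite AE => /orP[/eqP ->|uA']; [left; right | right; exists u].
move=> [[[Pf|[u uA ->]]|<-]|[u /sA'[uA _] ->]]; first by left.
- by right; exists u => //; left.
- by right; exists a => //; right.
by right; exists u => //; right.
Qed.

End VertexVariables.

(** * The cone *)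

(** The map [s] is onto, so S modulo the preimage of [J] is S'/J; regular and socle elements are
    lifted by the section [t]. *)
Lemma socle_depth_preimage (S S' : comNzRingType) (m : S -> Prop) (m' J : S' -> Prop)
    (s : {rmorphism S -> S'}) (t : S' -> S) k :
    cancel t s -> (forall f, m f -> m' (s f)) -> (forall f, m' f -> m (t f)) ->
  socle_depth m' k J -> socle_depth m k (fun f => J (s f)).
Proof.
move=> tK ms mt; elim: k J => [|k IH] J.
  move=> [u [nJu socu]]; exists (t u); rewrite /socle_elt tK; split=> // z /ms.
  by rewrite rmorphM tK; apply: socu.
move=> [f [mf regf /IH df]]; exists (t f); split; first exact: mt.
  by move=> g; rewrite rmorphM tK; apply: regf.
suff -> : ideal_add (fun f => J (s f)) (t f) = fun g => ideal_add J f (s g) by [].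
apply: ideal_ext => g.
  move=> [a [b [Ja ->]]]; exists (s a), (s b); split=> //.
  by rewrite rmorphD rmorphM tK.
move=> [a [b [Ja sg]]]; exists (g - t b * t f), (t b); split; last by ring.
by rewrite rmorphB rmorphM !tK sg addrK.
Qed.

(** The three conditions are bundled because r f - e(r) e(f) = (r - e(r)) f + e(r) (f - e(f)), whose
    first term is controlled by a f and b f. *)
Lemma is_ideal_fixed_mod (S : comNzRingType) (e : {rmorphism S -> S}) (J : S -> Prop) a b :
    is_ideal J -> (forall r f, J (a * f) -> J (b * f) -> J ((r - e r) * f)) ->
  is_ideal (fun f => J (f - e f) /\ J (a * f) /\ J (b * f)).
Proof.
move=> hJ Jab; have J0 := ideal0 hJ; split.
- by rewrite rmorph0 subr0 !mulr0.
- move=> f g [Jf [af bf]] [Jg [ag bg]]; rewrite rmorphD !mulrDr opprD addrACA.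
  by split; [|split]; apply: idealD.
- move=> r f [Jf [af bf]]; rewrite rmorphM !(mulrCA _ r).
  split; last by split; apply: idealMl.
  have -> : r * f - e r * e f = (r - e r) * f + e r * (f - e f) by ring.
  by apply: idealD; [|apply: Jab|apply: idealMl].
Qed.

Section VertexSubstitution.
Variables (K : fieldType) (V : finType) (k : nat) (fx fy : V -> {mpoly K[k]}).

Definition vsubst : {mpoly K[#|V| + #|V|]} -> {mpoly K[k]} :=
  comp_mpoly [tuple match split i with
                    | inl j => fx (enum_val j)
                    | inr j => fy (enum_val j)
                    end | i < #|V| + #|V|].

HB.instance Definition _ := GRing.RMorphism.on vsubst.

Lemma vsubst_x u : vsubst (xvar K u) = fx u.
Proof.
rewrite /vsubst /xvar comp_mpolyXU -tnth_nth tnth_mktuple.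
by rewrite (unsplitK (inl _)) enum_rankK.
Qed.

Lemma vsubst_y u : vsubst (yvar K u) = fy u.
Proof.
rewrite /vsubst /yvar comp_mpolyXU -tnth_nth tnth_mktuple.
by rewrite (unsplitK (inr _)) enum_rankK.
Qed.

Lemma vsubstC c : vsubst c%:MP = c%:MP.
Proof. exact: comp_mpolyC. Qed.

End VertexSubstitution.

Lemma rmorph_vertex_congr (K : fieldType) (V : finType) (S : comNzRingType)
    (I : S -> Prop) (s t : {rmorphism {mpoly K[#|V| + #|V|]} -> S}) :
    is_ideal I -> (forall c, s c%:MP = t c%:MP) ->
    (forall u, I (s (xvar K u) - t (xvar K u)) /\ I (s (yvar K u) - t (yvar K u))) ->
  forall f, I (s f - t f).
Proof.
move=> hI stC stX; apply: rmorph_mpoly_congr => // i.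
rewrite -(splitK i); case: (split i) => j; rewrite -[j]enum_valK /=.
  by case: (stX (enum_val j)).
by case: (stX (enum_val j)).
Qed.

Section ConeIdeals.
Variables (K : fieldType) (n : nat) (H : sgraph 'I_n).
Notation V := (option 'I_n : finType).
Notation S := {mpoly K[#|V| + #|V|]}.
Notation SH := {mpoly K[#|'I_n| + #|'I_n|]}.
Notation x := (@xvar K V).
Notation y := (@yvar K V).
Notation J := (@binomial_edge_ideal K _ H).
Notation JG := (@binomial_edge_ideal K _ (cone H)).

(* Sets x_v = y_v = 0. *)
Definition restrict : S -> SH := vsubst (oapp (@xvar K 'I_n) 0) (oapp (@yvar K 'I_n) 0).
Definition extend : SH -> S := vsubst (fun u => x (Some u)) (fun u => y (Some u)).

HB.instance Definition _ := GRing.RMorphism.on restrict.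
HB.instance Definition _ := GRing.RMorphism.on extend.

Definition restrictE := (vsubst_x, vsubst_y).

Lemma extendK : cancel extend restrict.
Proof.
move=> f; apply/eqP; rewrite -subr_eq0; apply/eqP.
apply: (@rmorph_vertex_congr K _ _ _ (restrict \o extend) idfun (is_ideal_zero SH)) => [c|u] /=.
  by rewrite /extend /restrict !vsubstC.
by rewrite /extend /restrict !restrictE /= !subrr.
Qed.

Lemma restrict_congr f : ideal_gen (@coords K V [set None]) (f - extend (restrict f)).
Proof.
have hN := is_ideal_gen (@coords K V [set None]).
apply: (@rmorph_vertex_congr K _ _ _ idfun (extend \o restrict) hN) => [c|u] /=.
  by rewrite /extend /restrict !vsubstC.
rewrite /extend /restrict !restrictE; case: u => [u|] /=.
  by rewrite !restrictE !subrr; split; apply: ideal0.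
by rewrite !rmorph0 !subr0; split; apply: ideal_gen_mem; exists None; rewrite ?inE //; [left|right].
Qed.

Lemma restrict_max f : @graded_max_ideal K V f -> @graded_max_ideal K 'I_n (restrict f).
Proof.
have hm := @is_ideal_max K 'I_n.
apply: (ideal_gen_sub (ideal_preimage _ hm)) => _ [u [->|->]] /=;
  rewrite /restrict restrictE; case: u => [u|] /=.
- exact: max_x.
- exact: ideal0.
- exact: max_y.
- exact: ideal0.
Qed.

Lemma extend_max f : @graded_max_ideal K 'I_n f -> @graded_max_ideal K V (extend f).
Proof.
have hm := @is_ideal_max K V.
apply: (ideal_gen_sub (ideal_preimage _ hm)) => _ [u [->|->]] /=;
  by rewrite /extend restrictE; first [exact: max_x | exact: max_y].
Qed.

Lemma extend_minor u w : extend (minor K u w) = minor K (Some u) (Some w).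
Proof. by rewrite /minor rmorphB !rmorphM /= /extend !restrictE. Qed.

Lemma restrict_minor u w : restrict (minor K (Some u) (Some w)) = minor K u w.
Proof. by rewrite -extend_minor extendK. Qed.

Lemma restrict_minor_apex (u w : option 'I_n) : ~~ (u && w) -> restrict (minor K u w) = 0.
Proof.
rewrite /minor rmorphB !rmorphM /= /restrict !restrictE.
by case: u w => [u|] [w|] //= _; rewrite ?(mul0r, mulr0, subrr).
Qed.

Lemma extend_J (I : S -> Prop) : is_ideal I ->
  (forall u w, adj H u w -> I (minor K (Some u) (Some w))) ->
  forall f, J f -> I (extend f).
Proof.
move=> hI adjI; apply: (ideal_gen_sub (ideal_preimage _ hI)) => _ [u [w [uw ->]]].
by rewrite /= extend_minor; apply: adjI.
Qed.

Lemma cone_edge_mem u w : adj (cone H) u w -> JG (minor K u w).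
Proof. by move=> uw; apply: ideal_gen_mem; exists u, w. Qed.

(* The preimage of J_H under [restrict] is J_H + (x_v, y_v). *)
Lemma cone_ideal_cap : ideal_cap (ideal_gen (@minors K V setT)) (fun f => J (restrict f)) = JG.
Proof.
have hJ : is_ideal J := is_ideal_gen _; have hJG : is_ideal JG := is_ideal_gen _.
apply: ideal_ext => f; last first.
  apply: ideal_gen_sub => [|_ [u [w [uw ->]]]].
    by apply: is_ideal_cap; [apply: is_ideal_gen | apply: ideal_preimage].
  split; first by apply: ideal_gen_mem; exists u, w; rewrite !inE.
  rewrite -/(minor K u w); have [|ap] := boolP (u && w); last first.
    by rewrite restrict_minor_apex //; apply: ideal0.
  case: u w uw => [u|] [w|] //= uw _; rewrite restrict_minor.
  by apply: ideal_gen_mem; exists u, w.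
move=> [minf Jf].
(* [Jf] already places [extend (restrict f)] in J_G. The claims on x_v f and y_v f strengthen the
   goal so that it can be checked on the minors alone. *)
suff [JGr _] : JG (f - extend (restrict f)) /\ JG (x None * f) /\ JG (y None * f).
  apply: (idealDr hJG _ JGr); rewrite -mulN1r; apply: idealMl => //.
  by apply: extend_J Jf => // u w uw; apply: cone_edge_mem.
have coordJG g h : JG (x None * h) -> JG (y None * h) ->
    ideal_gen (@coords K V [set None]) g -> JG (g * h).
  move=> JGx JGy; apply: (ideal_gen_sub (is_ideal_colon h hJG)) => p [u].
  by rewrite inE => /eqP -> [->|->].
have hI := @is_ideal_fixed_mod S (extend \o restrict) JG (x None) (y None) hJG
  (fun r f JGx JGy => coordJG _ f JGx JGy (restrict_congr r)).
apply: (ideal_gen_sub hI) minf.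
move=> _ [u [w [_ _ ->]]].
have [|ap] := boolP (u && w); last first.
  have JGuw : JG (minor K u w).
    case: u w ap => [u|] [w|] //= _; try exact: cone_edge_mem.
    by rewrite /minor subrr; apply: ideal0.
  rewrite /= restrict_minor_apex // rmorph0 subr0; split=> //.
  by split; apply: idealMl.
case: u w => [u|] [w|] // _; rewrite /= restrict_minor extend_minor subrr.
split; first exact: ideal0.
have JGv z : JG (minor K None (Some z)) by apply: cone_edge_mem.
split.
  (* Expansion of the vanishing 3 by 3 determinant in which the row of x's occurs twice; below, the
     row of y's is repeated instead. *)
  have -> : x None * minor K (Some u) (Some w) =
      x (Some u) * minor K None (Some w) - x (Some w) * minor K None (Some u).
    by rewrite /minor; ring.
  by apply: idealB => //; apply: idealMl.
have -> : y None * minor K (Some u) (Some w) =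
    y (Some u) * minor K None (Some w) - y (Some w) * minor K None (Some u).
  by rewrite /minor; ring.
by apply: idealB => //; apply: idealMl.
Qed.

End ConeIdeals.

(** * Depths of the ideals around J_G, and the theorem *)

Section DepthOfCone.
Variables (K : fieldType) (n : nat) (H : sgraph 'I_n).
Notation V := (option 'I_n : finType).
Notation m := (@graded_max_ideal K V).
Notation J := (@binomial_edge_ideal K _ H).
Notation apex := (@coords K V [set None]).
Notation A := (ideal_gen (@minors K V setT)).
Notation B := (fun f => J (restrict f)).

Lemma socle_depth_all_coords P : (forall f : {mpoly K[#|V| + #|V|]}, P f <-> coords setT f) ->
  socle_depth m 0 (ideal_gen P).
Proof.
move=> PE; have -> : ideal_gen P = m.
  by apply: ideal_gen_eq => f; rewrite PE; split=> [[u _ fu]|[u fu]]; exists u.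
by exists 1; split=> [/one_notin_max//|z mz]; rewrite mulr1.
Qed.

Lemma socle_depth_complete : socle_depth m n.+2 A.
Proof.
have -> : A = ideal_gen (pred_or (fun=> False) (minors setT)).
  by apply: ideal_gen_eq => f; split=> [|[]//]; right.
have <- : (0 + #|[set: V]|).+1 = n.+2 by rewrite cardsT card_option card_ord.
apply: socle_depth_clique.
- by apply/set0Pn; exists None.
- by move=> b _; split.
by apply: socle_depth_all_coords => f; split=> [[]//|]; right.
Qed.

Lemma restrict_preimage_sub I : is_ideal I -> sub_ideal apex I ->
    (forall u w, adj H u w -> I (minor K (Some u) (Some w))) ->
  sub_ideal B I.
Proof.
move=> hI apexI adjI f Jf; rewrite -(subrK (extend (restrict f)) f).
apply: idealD => //; last exact: extend_J Jf.
by apply: ideal_gen_sub (restrict_congr f).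
Qed.

Lemma apex_sub_preimage : sub_ideal apex B.
Proof.
have hJ : is_ideal J := is_ideal_gen _.
move=> f [u]; rewrite inE => /eqP -> [->|->]; rewrite /restrict restrictE; exact: ideal0.
Qed.

(** Minors through the apex are absorbed by x_v and y_v, and the binomials of [H] are among the
    remaining minors. *)
Lemma sum_complete_restrict :
  ideal_sum A B = ideal_gen (pred_or apex (minors (setT :\ None))).
Proof.
set I := ideal_gen (pred_or _ _); have hI : is_ideal I := is_ideal_gen _.
have hJ : is_ideal J := is_ideal_gen _; have hB : is_ideal B := ideal_preimage _ hJ.
have hA : is_ideal A := is_ideal_gen _.
have apexI : sub_ideal apex I by move=> f fa; apply: ideal_gen_mem; left.
have Ix : I (xvar K None) by apply: apexI; exists None; rewrite ?inE //; left.
have Iy : I (yvar K None) by apply: apexI; exists None; rewrite ?inE //; right.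
have Iminor u w : I (minor K (Some u) (Some w)).
  by apply: ideal_gen_mem; right; exists (Some u), (Some w); rewrite !inE.
have AI : sub_ideal A I.
  apply: ideal_gen_sub => // _ [u [w [_ _ ->]]].
  case: u => [u|]; last by apply: idealB => //; [apply: idealMr | apply: idealMl].
  case: w => [w|]; first exact: Iminor.
  by apply: idealB => //; [apply: idealMl | apply: idealMr].
have BI : sub_ideal B I by apply: restrict_preimage_sub.
apply: ideal_ext.
  by move=> _ [a [b [/AI Ia /BI Ib ->]]]; apply: idealD.
apply: ideal_gen_sub; first exact: is_ideal_sum.
move=> f [/apex_sub_preimage Bf|[u [w [_ _ ->]]]].
  by exists 0, f; split=> //; [apply: ideal0 | rewrite add0r].
exists (minor K u w), 0; split; [|exact: (ideal0 hB)|by rewrite addr0].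
by apply: ideal_gen_mem; exists u, w; rewrite !inE.
Qed.

Hypothesis Hdisc : disconnected H.

Lemma card_vertices : #|[set: V] :\ None| = n.
Proof.
apply/eqP; rewrite -eqSS -[X in _ == X.+1](card_ord n) -card_option -cardsT.
by rewrite (cardsD1 None [set: V]) inE.
Qed.

Lemma socle_depth_sum : socle_depth m n.+1 (ideal_sum A B).
Proof.
have <- : (0 + #|[set: V] :\ None|).+1 = n.+1 by rewrite card_vertices.
rewrite sum_complete_restrict.
apply: socle_depth_clique.
(* Disconnectedness provides a vertex, so the clique without the apex is not empty. *)
- by have [u _] := Hdisc; apply/set0Pn; exists (Some u); rewrite !inE.
- by move=> b; rewrite inE => /andP[nb _]; apply: free_coords.
apply: socle_depth_all_coords => f; split=> [[]|] [u _ fu]; [by exists u|by exists u|].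
case: u fu => [u|] fu; last by left; exists None; rewrite ?inE.
by right; exists (Some u); rewrite ?inE.
Qed.

(* C is generated by x_v, y_v and the binomials of two disjoint cliques that cover H
   and are not joined by an edge; being CM of dimension n + 2, it sees that H is
   disconnected. *)
Lemma separating_ideal : exists C,
  [/\ is_ideal C, sub_ideal B C, sub_ideal C (ideal_sum A B) & socle_depth m n.+2 C].
Proof.
have [u0 [w0 nconn]] := Hdisc.
(* The component of [u0] and the union of all others; the default [false] leaves the apex out of
   both. *)
pose A1 : {set V} := [set v | oapp (connect H u0) false v].
pose A2 : {set V} := [set v | oapp (fun i => ~~ connect H u0 i) false v].
have A12 b : b \in A1 -> b \notin A2 by case: b => [b|]; rewrite !inE //= => ->.
have A21 b : b \in A2 -> b \notin A1 by case: b => [b|]; rewrite !inE.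
have cover u : [|| Some u \in A1 | Some u \in A2] by rewrite !inE /=; case: connect.
have cardA12 : (#|A1| + #|A2|)%N = n.
  rewrite -[RHS]card_vertices -cardsUI.
  have -> : A1 :&: A2 = set0.
    by apply/setP => b; rewrite !in_setI in_set0; apply/negP => /andP[/A12/negP].
  rewrite cards0 addn0; apply: eq_card => -[b|]; rewrite !inE //=.
  by case: connect.
pose C := ideal_gen (pred_or (pred_or apex (minors A1)) (minors A2)).
have hC : is_ideal C := is_ideal_gen _.
exists C; split=> //.
- apply: restrict_preimage_sub => // [f fa|u w uw].
    by apply: ideal_gen_mem; left; left.
  apply: ideal_gen_mem; have conn_uw : connect H u0 u = connect H u0 w.
    apply/idP/idP => [u0u|u0w]; first exact: connect_trans u0u (connect1 uw).
    by apply: connect_trans u0w (connect1 _); rewrite adj_sym.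
  have [u0u|nu0u] := boolP (connect H u0 u).
    by left; right; exists (Some u), (Some w); rewrite !inE /= -conn_uw u0u.
  by right; exists (Some u), (Some w); rewrite !inE /= -conn_uw nu0u.
- have somes b : (b \in A1) || (b \in A2) -> b \in [set: V] :\ None.
    by case: b => [b|]; rewrite !inE.
  rewrite sum_complete_restrict; apply: ideal_gen_mono => f.
  move=> [[fa|[u [w [uA wA ->]]]]|[u [w [uA wA ->]]]]; first by left.
    by right; exists u, w; split=> //; apply: somes; rewrite ?uA ?wA ?orbT.
  by right; exists u, w; split=> //; apply: somes; rewrite ?uA ?wA ?orbT.
have apex_free b : b \in A1 \/ b \in A2 -> free_vertex apex b.
  by move=> bA; apply: free_coords; case: b bA => [b|]; rewrite !inE //= => -[].
(* Each of the two cliques contributes its number of vertices plus one, whence n + 2. *)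
have <- : ((0 + #|A1|).+1 + #|A2|).+1 = n.+2 by rewrite add0n addSn cardA12.
apply: socle_depth_clique.
- by apply/set0Pn; exists (Some w0); rewrite inE.
- move=> b bA; apply: free_vertex_or; first by apply: apex_free; right.
  exact/free_minors/A21.
rewrite (@ideal_gen_eq _ _ (pred_or (pred_or apex (coords A2)) (minors A1))); last first.
  by move=> f; rewrite /pred_or; tauto.
apply: socle_depth_clique.
- by apply/set0Pn; exists (Some u0); rewrite inE /=.
- move=> b bA; apply: free_vertex_or; first by apply: apex_free; left.
  exact/free_coords/A12.
apply: socle_depth_all_coords => f; split=> [[[]|]|] [u _ fu]; try by exists u.
case: u fu => [u|] fu; last by left; left; exists None; rewrite ?inE.
have /orP[uA1|uA2] := cover u; first by right; exists (Some u).
by left; right; exists (Some u).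
Qed.

End DepthOfCone.

Local Close Scope ring_scope.

(** Depth being a relation, the value [d] must be shown to exist; [is_depth_inj] makes it unique, so
    this is the asserted equality. *)
Theorem theorem3p9 (K : fieldType) (n : nat) (H : sgraph 'I_n)
    (Hdisc : disconnected H) :
  exists d : nat,
    depth_mod_J K H d /\ depth_mod_J K (cone H) (minn d (n + 2)).
Proof.
have hJ : is_ideal (binomial_edge_ideal (K := K) H) := is_ideal_gen _.
have hm := @is_ideal_max K 'I_n.
have hM := @is_ideal_max K (option 'I_n).
have noeth k := @noetherian_mpoly K k.
have [||d dJ] := socle_depth_exists (noeth _) hm hJ.
- apply: ideal_gen_sub => // _ [u [w [_ ->]]].
  by apply: idealB => //; apply: idealMr => //; apply: max_x.
- exact: one_notin_max.
exists d; split; first exact: (socle_depth_is_depth (noeth _) hm hJ dJ).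
have hB := ideal_preimage (restrict (K := K) (n := n)) hJ.
have hA := is_ideal_gen (@minors K (option 'I_n) setT).
have [C [hC BC CAB dC]] := separating_ideal K Hdisc.
have dB := socle_depth_preimage (@extendK K n) (@restrict_max K n) (@extend_max K n) dJ.
have := socle_depth_cap (noeth _) hM hA hB hC BC CAB
  (socle_depth_complete K n) dC (socle_depth_sum K Hdisc) dB.
rewrite /depth_mod_J -cone_ideal_cap addn2.
exact: (socle_depth_is_depth (noeth _) hM (is_ideal_cap hA hB)).
Qed.
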